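(* Let $d$ be a positive integer and $J\subsetneq I$ square free monomial ideals of $S=K[x_1,\ldots,x_n]$ ($J$ possibly zero) such that $I$ is generated in degrees $\geq d$ and $\rho_d(I)>0$. If $\operatorname{sdepth}_S I/J=d$, then $\operatorname{depth}_S I/J=d$; in particular Stanley's inequality $\operatorname{sdepth}_S I/J\geq\operatorname{depth}_S I/J$ holds in this case.
   Context: $K$ is a field; for a monomial ideal $L$, $\rho_k(L)$ denotes the number of square free monomials of degree $k$ belonging to $L$; depth is taken over $S$. Stanley depth: let $P_{I\setminus J}$ be the (finite) poset of all square free monomials in $I\setminus J$, ordered by divisibility. For a partition $\mathcal P$ of $P_{I\setminus J}$ into disjoint intervals $[u_i,v_i]=\{w\in P_{I\setminus J}: u_i\mid w,\ w\mid v_i\}$, set $\operatorname{sdepth}\mathcal P=\min_i\deg v_i$; then $\operatorname{sdepth}_S I/J=\max_{\mathcal P}\operatorname{sdepth}\mathcal P$, the maximum over all such partitions. *)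

(* Defs.v *)
From HB Require Import structures.
From mathcomp Require Import all_boot all_order all_algebra.
Set Implicit Arguments. Unset Strict Implicit. Unset Printing Implicit Defensive.
Import GRing.Theory.
Local Open Scope ring_scope.

Fixpoint mp (R : comNzRingType) (n : nat) : comNzRingType :=
  match n with
  | 0 => R
  | n'.+1 => ({poly mp R n'} : comNzRingType)
  end.

Fixpoint mvar (R : comNzRingType) (n : nat) (i : nat) : mp R n :=
  match n return mp R n with
  | 0 => 0
  | n'.+1 => if i == n' then ('X : {poly mp R n'}) else (mvar R n' i)%:P
  end.

Definition sqmon (R : comNzRingType) (n : nat) (A : {set 'I_n}) : mp R n :=
  \prod_(i in A) mvar R n i.
Arguments sqmon R {n} A.

Definition in_mideal (R : comNzRingType) (n : nat) (G : {set {set 'I_n}})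
    (f : mp R n) : Prop :=
  exists c : {set 'I_n} -> mp R n, f = \sum_(B in G) c B * sqmon R B.

Definition in_maxideal (R : comNzRingType) (n : nat) (f : mp R n) : Prop :=
  exists c : 'I_n -> mp R n, f = \sum_(i < n) c i * mvar R n i.

Definition rho_pos (R : comNzRingType) (n : nat) (G : {set {set 'I_n}}) (k : nat)
  : Prop := exists A : {set 'I_n}, #|A| = k /\ in_mideal G (sqmon R A).

(* u lies in the submodule J + (f_0,...,f_{k-1}) I of S, i.e. u represents zero
   in the module (I/J) / (f_0,...,f_{k-1})(I/J). *)
Definition in_sub (R : comNzRingType) (n : nat) (GI GJ : {set {set 'I_n}})
    (fs : seq (mp R n)) (u : mp R n) : Prop :=
  exists j, in_mideal GJ j /\
  exists a : nat -> mp R n, (forall i, (i < size fs)%N -> in_mideal GI (a i)) /\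
    u = j + \sum_(i < size fs) fs`_i * a i.

Definition regular_seq (R : comNzRingType) (n : nat) (GI GJ : {set {set 'I_n}})
    (fs : seq (mp R n)) : Prop :=
  [/\ (forall f, f \in fs -> in_maxideal f),
      (forall k, (k < size fs)%N -> forall u, in_mideal GI u ->
          in_sub GI GJ (take k fs) (fs`_k * u) -> in_sub GI GJ (take k fs) u)
    & exists u, in_mideal GI u /\ ~ in_sub GI GJ fs u].

Definition depth_eq (R : comNzRingType) (n : nat) (GI GJ : {set {set 'I_n}})
    (d : nat) : Prop :=
  (exists fs : seq (mp R n), regular_seq GI GJ fs /\ size fs = d) /\
  (forall fs : seq (mp R n), regular_seq GI GJ fs -> (size fs <= d)%N).

Definition inP (R : comNzRingType) (n : nat) (GI GJ : {set {set 'I_n}})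
    (A : {set 'I_n}) : Prop :=
  in_mideal GI (sqmon R A) /\ ~ in_mideal GJ (sqmon R A).

Definition in_interval (R : comNzRingType) (n : nat) (GI GJ : {set {set 'I_n}})
    (p : {set 'I_n} * {set 'I_n}) (W : {set 'I_n}) : Prop :=
  inP R GI GJ W /\ p.1 \subset W /\ W \subset p.2.

Definition stanley_partition (R : comNzRingType) (n : nat)
    (GI GJ : {set {set 'I_n}}) (Pt : {set {set 'I_n} * {set 'I_n}}) : Prop :=
  [/\ (forall p, p \in Pt -> [/\ inP R GI GJ p.1, inP R GI GJ p.2 & p.1 \subset p.2]),
      (forall p q W, p \in Pt -> q \in Pt -> in_interval R GI GJ p W ->
          in_interval R GI GJ q W -> p = q)
    & (forall W, inP R GI GJ W -> exists2 p, p \in Pt & in_interval R GI GJ p W)].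

(* sdepth of a partition: min_i deg v_i (n is a top element: all degrees <= n). *)
Definition sdepth_part (n : nat) (Pt : {set {set 'I_n} * {set 'I_n}}) : nat :=
  \big[minn/n]_(p in Pt) #|p.2|.

Definition sdepth_eq (R : comNzRingType) (n : nat) (GI GJ : {set {set 'I_n}})
    (d : nat) : Prop :=
  (exists Pt, stanley_partition R GI GJ Pt /\ sdepth_part Pt = d) /\
  (forall Pt, stanley_partition R GI GJ Pt -> (sdepth_part Pt <= d)%N).

Definition ideal_sub (R : comNzRingType) (n : nat) (GJ GI : {set {set 'I_n}}) : Prop :=
  forall f : mp R n, in_mideal GJ f -> in_mideal GI f.

(* Main.v *)
Require Import Defs.
From HB Require Import structures.
From mathcomp Require Import all_boot all_order all_algebra all_fingroup.
From mathcomp Require Import ring zify.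

(* Let P_k be the set of squarefree monomials of degree k in I \ J. In
   multidegree (1, ..., 1) the Koszul complex of I / J is a complex
   K^(P_d) -> K^(P_(d+1)) -> ... starting in degree d. If its first map were
   injective, a nonzero maximal minor would give a matching of P_d into P_(d+1)
   along divisibility, hence a partition into intervals of Stanley depth > d. So
   this map has a nonzero kernel, which is a nonzero Koszul class in a degree that
   forces depth I / J <= d.
   Conversely the complete homogeneous symmetric polynomials h_1, ..., h_d form a
   regular sequence. In n variables h_(k+1) = h'_(k+1) + x h_k, where h' is in
   the first n - 1 variables and h_k is monic in the last variable x; splitting
   I / J by divisibility by x, one proves by induction on n that any d consecutive
   h_j, ..., h_(j+d-1) are weakly regular on I / J. *)

Set Implicit Arguments.
Unset Strict Implicit.
Unset Printing Implicit Defensive.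
Import GRing.Theory.
Local Open Scope ring_scope.

(** * Weakly regular sequences on subquotients *)

Record is_ideal (R : comNzRingType) (I : R -> Prop) : Prop := IsIdeal {
  ideal0 : I 0;
  idealD : forall u v, I u -> I v -> I (u + v);
  idealM : forall a u, I u -> I (a * u)
}.

Section Ideals.
Variables (R : comNzRingType) (I : R -> Prop).
Hypothesis idI : is_ideal I.

Lemma idealN u : I u -> I (- u).
Proof. by move=> Iu; rewrite -mulN1r; apply: idealM. Qed.

Lemma idealB u v : I u -> I v -> I (u - v).
Proof. by move=> Iu Iv; apply: idealD => //; apply: idealN. Qed.

Lemma ideal_sum (T : finType) (P : pred T) (F : T -> R) :
  (forall t, P t -> I (F t)) -> I (\sum_(t | P t) F t).
Proof.
by move=> IF; apply: big_ind => //; [apply: ideal0 | apply: idealD].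
Qed.

Lemma idealBr u v : I (u - v) -> I v -> I u.
Proof. by move=> Iuv Iv; rewrite -(subrK v u); apply: idealD. Qed.

End Ideals.

Definition add_mul (R : comNzRingType) (I J : R -> Prop) (f u : R) : Prop :=
  exists2 a, I a & J (u - f * a).

(* [fs] is weakly regular on I / J: here [add_mul I J f] is the ideal J + f I. *)
Fixpoint wreg (R : comNzRingType) (I J : R -> Prop) (fs : seq R) : Prop :=
  if fs is f :: fs' then
    (forall u, I u -> J (f * u) -> J u) /\ wreg I (add_mul I J f) fs'
  else True.

Section AddMul.
Variables (R : comNzRingType) (I J : R -> Prop).
Hypotheses (idI : is_ideal I) (idJ : is_ideal J).

Lemma ideal_add_mul f : is_ideal (add_mul I J f).
Proof.
split=> [|u v [a Ia Ja] [b Ib Jb]|c u [a Ia Ja]].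
- by exists 0; [apply: ideal0 | rewrite mulr0 subr0; apply: ideal0].
- exists (a + b); first exact: idealD.
  have -> : u + v - f * (a + b) = (u - f * a) + (v - f * b) by ring.
  exact: idealD.
- exists (c * a); first exact: idealM.
  have -> : c * u - f * (c * a) = c * (u - f * a) by ring.
  exact: idealM.
Qed.

Lemma sub_add_mul f u : J u -> add_mul I J f u.
Proof. by move=> Ju; exists 0; [apply: ideal0 | rewrite mulr0 subr0]. Qed.

Lemma mul_add_mul f u : I u -> add_mul I J f (f * u).
Proof. by move=> Iu; exists u => //; rewrite subrr; apply: ideal0. Qed.

Lemma add_mul_sub f :
  (forall u, J u -> I u) -> forall u, add_mul I J f u -> I u.
Proof.
move=> JI u [a Ia Ja].
by apply: (idealBr idI) (JI _ Ja) _; apply: idealM.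
Qed.

End AddMul.

(** The relation [rho] stands for an isomorphism of I / J with I' / J', possibly over different
    rings, so quotient modules never have to be formed. Its compatibility with [J] and [J'] survives
    the passage to [add_mul], which carries the induction. *)
Lemma wreg_rel (R R' : comNzRingType) (I J : R -> Prop) (I' J' : R' -> Prop)
    (rho : R -> R' -> Prop) (T : Type) (f : T -> R) (f' : T -> R') (s : seq T) :
  (forall u, I u -> exists2 u', I' u' & rho u u') ->
  (forall u', I' u' -> exists2 u, I u & rho u u') ->
  (forall u u' v v', rho u u' -> rho v v' -> rho (u - v) (u' - v')) ->
  (forall t u u', rho u u' -> rho (f t * u) (f' t * u')) ->
  (forall u u', rho u u' -> J u <-> J' u') ->
  wreg I J (map f s) -> wreg I' J' (map f' s).
Proof.
move=> exl exr rhoB rhoM; elim: s J J' => [//|t s IHs] J J' JJ' /= [nzd reg].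
split=> [u' Iu' Ju'|].
  have [u Iu uu'] := exr _ Iu'.
  by apply/(JJ' _ _ uu')/nzd => //; apply/(JJ' _ _ (rhoM t _ _ uu')).
apply: IHs reg => u u' uu'; split=> [[a Ia Ja]|[a' Ia' Ja']].
  have [a' Ia' aa'] := exl _ Ia; exists a' => //.
  by apply/(JJ' _ _ (rhoB _ _ _ _ uu' (rhoM t _ _ aa'))).
have [a Ia aa'] := exr _ Ia'; exists a => //.
by apply/(JJ' _ _ (rhoB _ _ _ _ uu' (rhoM t _ _ aa'))).
Qed.

Lemma eq_wreg (R : comNzRingType) (I I' J J' : R -> Prop) (fs : seq R) :
  (forall u, I u <-> I' u) -> (forall u, J u <-> J' u) ->
  wreg I J fs -> wreg I' J' fs.
Proof.
move=> II' JJ'; rewrite -[fs]map_id; apply: (@wreg_rel _ _ _ _ _ _ eq).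
- by move=> u /II' Iu; exists u.
- by move=> u /II' Iu; exists u.
- by move=> u u' v v' -> ->.
- by move=> f u u' ->.
- by move=> u u' <-.
Qed.

(** The subquotient is zero here, and weak regularity does not ask for a nonzero quotient. *)
Lemma wreg_sub (R : comNzRingType) (I J : R -> Prop) (fs : seq R) :
  (forall u, I u -> J u) -> is_ideal I -> is_ideal J -> wreg I J fs.
Proof.
move=> IJ idI; elim: fs J IJ => [//|f fs IHfs] J IJ idJ /=; split=> [u Iu _|].
  exact: IJ.
by apply: IHfs => [u Iu|]; [apply/sub_add_mul/IJ | apply: ideal_add_mul].
Qed.

(** In 0 -> L/J -> I/J -> I/L -> 0, regularity of [f] on the outer terms gives it on the middle one,
    and the sequence stays exact modulo [f], so the induction continues. *)
Lemma wreg_extension (R : comNzRingType) (I L J : R -> Prop) (fs : seq R) :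
  is_ideal I -> is_ideal L -> is_ideal J ->
  (forall u, J u -> L u) -> (forall u, L u -> I u) ->
  wreg L J fs -> wreg I L fs -> wreg I J fs.
Proof.
move=> idI; elim: fs L J => [//|f fs IHfs] L J idL idJ JL LI /=.
move=> [nzdLJ regLJ] [nzdIL regIL]; split=> [u Iu Ju|].
  by apply: nzdLJ => //; apply: nzdIL => //; apply: JL.
have idL' := ideal_add_mul idI idL f; have idJ' := ideal_add_mul idI idJ f.
apply: IHfs regIL => //.
- by move=> u [a Ia Ja]; exists a => //; apply: JL.
- exact: add_mul_sub.
(* (L + fI) / (J + fI) is L / (J + fL), because f is regular on I / L *)
move: regLJ; rewrite -[fs]map_id.
apply: (@wreg_rel _ _ _ _ _ _
  (fun u u' => L u /\ add_mul I J f (u' - u))).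
- move=> u Lu; exists u; first exact: sub_add_mul.
  by split=> //; rewrite subrr; apply: ideal0.
- move=> u [a Ia La]; exists (u - f * a) => //; split=> //.
  by rewrite opprB addrC subrK; apply: mul_add_mul.
- move=> u u' v v' [Lu Ju] [Lv Jv]; split; first exact: idealB.
  have -> : u' - v' - (u - v) = (u' - u) - (v' - v) by ring.
  exact: idealB.
- move=> t u u' [Lu Ju]; split; first exact: idealM.
  by rewrite -mulrBr; apply: idealM.
- move=> u u' [Lu Ju']; split=> [[a La Ja]|Ju].
    apply: (idealBr idJ') Ju' _.
    by exists a => //; apply: LI.
  have [a Ia Ja] : add_mul I J f u.
    by rewrite -[u](subKr u'); apply: idealB.
  exists a => //; apply: nzdIL => //.
  by rewrite -[_ * _](subKr u); apply: idealB => //; apply: JL.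
Qed.

(** This is [in_sub] with the two ideals abstracted, so that [wregP] applies to the second clause of
    [regular_seq] by conversion. *)
Definition in_add (R : comNzRingType) (I J : R -> Prop) (fs : seq R) (u : R) :=
  exists j, J j /\ exists a : nat -> R,
    (forall i, (i < size fs)%N -> I (a i)) /\
    u = j + \sum_(i < size fs) fs`_i * a i.

Lemma in_add_nil (R : comNzRingType) (I J : R -> Prop) u :
  in_add I J [::] u <-> J u.
Proof.
split=> [[j [Jj [a [_ ->]]]]|Ju]; first by rewrite big_ord0 addr0.
by exists u; split=> //; exists (fun=> 0); split=> //; rewrite big_ord0 addr0.
Qed.

Lemma in_add_cons (R : comNzRingType) (I J : R -> Prop) f fs u :
  in_add I J (f :: fs) u <-> in_add I (add_mul I J f) fs u.
Proof.
split=> [[j [Jj [a [Ia ->]]]]|[j [[b Ib Jb] [a [Ia ->]]]]].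
  exists (j + f * a 0%N); split.
    by exists (a 0%N); [apply: Ia | rewrite addrK].
  exists (fun i => a i.+1); split=> [i|]; first exact: (Ia i.+1).
  by rewrite big_ord_recl /= addrA.
exists (j - f * b); split=> //; exists (fun i => if i is i'.+1 then a i' else b).
by split=> [[|i]|] //=; [apply: Ia | rewrite big_ord_recl /= addrA subrK].
Qed.

Lemma wregP (R : comNzRingType) (I J : R -> Prop) (fs : seq R) :
  wreg I J fs <->
  (forall k, (k < size fs)%N -> forall u, I u ->
     in_add I J (take k fs) (fs`_k * u) -> in_add I J (take k fs) u).
Proof.
elim: fs J => [//|f fs IHfs] J /=; split=> [[nzd /IHfs reg] [|k] ltk u Iu|reg].
- by move=> /in_add_nil Ju; apply/in_add_nil/nzd.
- by move=> /in_add_cons Ju; apply/in_add_cons/reg.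
split=> [u Iu Ju|].
  by apply/(in_add_nil I J)/(reg 0%N) => //; apply/in_add_nil.
apply/IHfs => k ltk u Iu Ju.
by apply/(in_add_cons I J)/(reg k.+1) => //; apply/in_add_cons.
Qed.

(** * Adjoining a variable *)

Definition coef_in (R : comNzRingType) (I : R -> Prop) (p : {poly R}) : Prop :=
  forall k, I p`_k.

(* I0 + x I1[x], an ideal only if I0 is contained in I1. *)
Definition coef_in2 (R : comNzRingType) (I0 I1 : R -> Prop) (p : {poly R}) : Prop :=
  I0 p`_0 /\ forall k, I1 p`_k.+1.

Lemma ideal_coef_in2 (R : comNzRingType) (I0 I1 : R -> Prop) :
  is_ideal I0 -> is_ideal I1 -> (forall u, I0 u -> I1 u) ->
  is_ideal (coef_in2 I0 I1).
Proof.
move=> id0 id1 I01; split=> [|u v [u0 u1] [v0 v1]|a u [u0 u1]].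
- by split=> [|k]; rewrite coef0; apply: ideal0.
- by split=> [|k]; rewrite coefD; apply: idealD.
have u' k : I1 u`_k by case: k => [|k]; [apply: I01 | apply: u1].
split=> [|k]; rewrite coefM; last by apply: ideal_sum => // i _; apply: idealM.
by rewrite big_ord1; apply: idealM.
Qed.

Lemma coef_in2E (R : comNzRingType) (I : R -> Prop) p :
  coef_in2 I I p <-> coef_in I p.
Proof. by split=> [[p0 p1] [|k]|Ip] //; split. Qed.

Section CoefIn.
Variables (R : comNzRingType) (I : R -> Prop).
Hypothesis idI : is_ideal I.

Lemma ideal_coef_in : is_ideal (coef_in I).
Proof.
have [H0 HD HM] := ideal_coef_in2 idI idI (fun u Iu => Iu).
split=> [|u v Iu Iv|a u Iu]; apply/coef_in2E => //.
  by apply: HD; apply/coef_in2E.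
by apply: HM; apply/coef_in2E.
Qed.

Lemma coef_in_scale (c : R) p : I c -> coef_in I (c *: p).
Proof. by move=> Ic k; rewrite coefZ mulrC; apply: idealM. Qed.

(** Dividing each power of 'X separately makes quotient and remainder linear in the coefficients of
    [u], which keeps them in I[x]. *)
Lemma coef_in_monic_div (h u : {poly R}) : h \is monic -> coef_in I u ->
  exists q r, [/\ coef_in I q, coef_in I r, u = h * q + r & (size r < size h)%N].
Proof.
move=> mon_h Iu; pose E k := Pdiv.Ring.rdivp ('X^k : {poly R}) h.
pose M k := Pdiv.Ring.rmodp ('X^k : {poly R}) h.
exists (\sum_(k < size u) u`_k *: E k), (\sum_(k < size u) u`_k *: M k); split.
- by apply: (ideal_sum ideal_coef_in) => k _; apply: coef_in_scale.
- by apply: (ideal_sum ideal_coef_in) => k _; apply: coef_in_scale.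
- rewrite mulr_sumr -big_split /= -[LHS]coefK poly_def; apply: eq_bigr => k _.
  rewrite -scalerAr -scalerDr mulrC; congr (_ *: _).
  exact: Pdiv.RingMonic.rdivp_eq.
have h0 : h != 0 by rewrite monic_neq0.
rewrite -[size h]prednK ?size_poly_gt0 // ltnS.
apply: leq_trans (size_sum _ _ _) _; apply/bigmax_leqP => k _.
apply: leq_trans (size_scale_leq _ _) _.
by rewrite -ltnS prednK ?size_poly_gt0 // Pdiv.Ring.ltn_rmodp.
Qed.

(** As [h] is monic, the leading coefficient of [h * a] is that of [a], and it sits above the degree
    of [p]; hence it lies in I. Removing the leading term of [a] leaves a smaller instance. *)
Lemma coef_in_monic_mul (h p a : {poly R}) : h \is monic ->
  (size p < size h)%N -> coef_in I (h * a - p) -> coef_in I a.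
Proof.
move=> mon_h lt_ph; have [n] := ubnP (size a); elim: n a => // n IHn a.
rewrite ltnS => le_an Ia; have [->|a0] := eqVneq a 0.
  by move=> k; rewrite coef0; apply: ideal0.
have Il : I (lead_coef a).
  have := Ia (size (h * a)).-1; rewrite coefB [p`__]nth_default ?subr0.
    by rewrite -lead_coefE lead_coef_monicM.
  rewrite size_monicM //.
  move: a0 lt_ph; rewrite -size_poly_gt0. by move: (size a) (size h) (size p) => *; lia.
pose m := (size a).-1; have sza : size a = m.+1.
  by rewrite /m prednK ?size_poly_gt0.
have am : lead_coef a = a`_m by [].
pose t := lead_coef a *: 'X^m; have It : coef_in I t by apply: coef_in_scale.
rewrite -(subrK t a); apply: (idealD ideal_coef_in) => //.
apply: IHn.
  apply: leq_trans le_an; rewrite sza ltnS; apply/leq_sizeP => j le_mj.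
  rewrite coefB coefZ coefXn am; case: eqVneq => [->|ne_jm].
    by rewrite mulr1 subrr.
  by rewrite mulr0 subr0 nth_default // sza ltn_neqAle eq_sym ne_jm.
rewrite mulrBr addrAC; apply: (idealB ideal_coef_in) => //.
exact: (idealM ideal_coef_in).
Qed.

End CoefIn.

Lemma coef_in_add_mul (R : comNzRingType) (I J : R -> Prop) f u :
  is_ideal I -> is_ideal J ->
  coef_in (add_mul I J f) u <-> add_mul (coef_in I) (coef_in J) f%:P u.
Proof.
move=> idI idJ; split=> [Iu|[a Ia Ja] k]; last first.
  by exists a`_k; [apply: Ia | rewrite -coefCM -coefB; apply: Ja].
(* One witness per coefficient of [u], finitely many in all, assembled below into a single
   polynomial. *)
have /fin_all_exists [a Ha] : forall k : 'I_(size u),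
    exists a, I a /\ J (u`_k - f * a) by move=> k; have [a Ia Ja] := Iu k; exists a.
pose b k := if insub k is Some k' then a k' else 0.
exists (\poly_(k < size u) b k) => k; rewrite ?coefB ?coefCM coef_poly;
  case: ltnP => lt_k; rewrite /b ?insubT.
- by case: (Ha (Ordinal lt_k)).
- exact: ideal0.
- by case: (Ha (Ordinal lt_k)).
- by rewrite mulr0 subr0 nth_default //; apply: ideal0.
Qed.

(** Division by [h] identifies I[x] / (J[x] + h I[x]) with a direct sum of copies of I / J, one per
    power of x below the degree of [h]; constants act on each copy separately. *)
Lemma wreg_monic (R : comNzRingType) (I J : R -> Prop) (h : {poly R}) fs :
  is_ideal I -> is_ideal J -> h \is monic ->
  wreg I J fs ->
  wreg (coef_in I) (add_mul (coef_in I) (coef_in J) h) [seq f%:P | f <- fs].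
Proof.
move=> idI idJ mon_h; have idIx := ideal_coef_in idI.
elim: fs J idJ => [//|f fs IHfs] J idJ /= [nzd reg]; have idJx := ideal_coef_in idJ.
split=> [u Iu Ju|].
  have [q [r [Iq Ir Du lt_rh]]] := coef_in_monic_div idI mon_h Iu.
  exists q => //; rewrite Du addrC addKr.
  have [a Ia Ja] : add_mul (coef_in I) (coef_in J) h (f%:P * r).
    apply: (idealBr (ideal_add_mul idIx idJx h) _ Ju).
    exists (- (f%:P * q)); first by apply/(idealN idIx)/(idealM idIx).
    suff -> : f%:P * r - f%:P * u - h * - (f%:P * q) = 0 by exact: ideal0.
    by rewrite Du; ring.
  (* [f%:P * r] is congruent to [h * a] modulo J[x] but shorter than [h], so [a] itself has
     coefficients in J. *)
  have Jfr : coef_in J (f%:P * r).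
    apply: (idealBr idJx (Ja)); apply: (idealM idJx).
    apply: (coef_in_monic_mul idJ mon_h (p := f%:P * r)).
      by rewrite mul_polyC (leq_ltn_trans (size_scale_leq _ _)).
    by rewrite -opprB; apply: (idealN idJx).
  by move=> k; apply: nzd; rewrite -?coefCM.
(* Quotients by [h] and by the constant [f] may be taken in either order. *)
apply: eq_wreg (IHfs _ (ideal_add_mul idI idJ f) reg) => // u.
split=> [[a Ia /(coef_in_add_mul _ _ idI idJ) [b Ib Jb]]|[b Ib [a Ia Ja]]].
  by exists b => //; exists a => //; rewrite addrAC.
exists a => //; apply/(coef_in_add_mul _ _ idI idJ); exists b => //.
by rewrite addrAC.
Qed.

(* Modulo [g j, ..., g (k - 1)], the recursion gives [g k = g' k]. *)
Lemma wreg_perturb (R : comNzRingType) (I J : R -> Prop) (g g' : nat -> R) x j d :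
  is_ideal I -> is_ideal J -> (forall k, g k.+1 = g' k.+1 + x * g k) ->
  (forall a, I a -> J (g j * a)) ->
  wreg I J [seq g' k | k <- iota j.+1 d] -> wreg I J [seq g k | k <- iota j.+1 d].
Proof.
move=> idI idJ rec_g; elim: d j J idJ => [//|d IHd] j J idJ gJ /= [nzd reg].
have gg' a : I a -> J (g j.+1 * a - g' j.+1 * a).
  move=> Ia; have -> : g j.+1 * a - g' j.+1 * a = g j * (x * a).
    by rewrite rec_g; ring.
  exact/gJ/(idealM idI).
split=> [u Iu Ju|].
  apply: nzd => //; rewrite -[_ * _](subKr (g j.+1 * u)).
  by apply: idealB => //; apply: gg'.
apply: IHd => [|a Ia|]; [exact: ideal_add_mul | exact: mul_add_mul | ].
apply: eq_wreg reg => // u; split=> [[a Ia Ja]|[a Ia Ja]]; exists a => //.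
  have -> : u - g j.+1 * a = (u - g' j.+1 * a) - (g j.+1 * a - g' j.+1 * a) by ring.
  by apply: idealB => //; apply: gg'.
have -> : u - g' j.+1 * a = (u - g j.+1 * a) + (g j.+1 * a - g' j.+1 * a) by ring.
by apply: idealD => //; apply: gg'.
Qed.

(** The intermediate ideal J0 + x I1[x] separates the part free of x from the part divisible by x.
    On the former [H k] acts as [h k]; on the latter the monic [H j] is spent first, so I1 / J1 has
    to support one element fewer. *)
Lemma wreg_coef_in2 (R : comNzRingType) (I0 I1 J0 J1 : R -> Prop)
    (h : nat -> R) (H : nat -> {poly R}) j d :
  is_ideal I0 -> is_ideal I1 -> is_ideal J0 -> is_ideal J1 ->
  (forall u, I0 u -> I1 u) -> (forall u, J0 u -> J1 u) ->
  (forall u, J0 u -> I0 u) -> (forall u, J1 u -> I1 u) ->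
  (forall k, (H k)`_0 = h k) -> (forall k, H k.+1 = (h k.+1)%:P + 'X * H k) ->
  H j \is monic ->
  wreg I0 J0 [seq h k | k <- iota j d.+1] ->
  wreg I1 J1 [seq h k | k <- iota j.+1 d] ->
  wreg (coef_in2 I0 I1) (coef_in2 J0 J1) [seq H k | k <- iota j d.+1].
Proof.
move=> idI0 idI1 idJ0 idJ1 I01 J01 JI0 JI1 H0 Hrec mon_Hj reg0 reg1.
have idI := ideal_coef_in2 idI0 idI1 I01.
have idJ := ideal_coef_in2 idJ0 idJ1 J01.
have JI1' u : J0 u -> I1 u by move=> /JI0/I01.
have idL := ideal_coef_in2 idJ0 idI1 JI1'.
apply: (wreg_extension idI idL idJ).
- by move=> u [u0 u1]; split=> // k; apply: JI1.
- by move=> u [u0 u1]; split=> //; apply: JI0.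
- have reg : wreg (coef_in I1) (coef_in J1) [seq H k | k <- iota j d.+1].
    split=> [u Iu Ju|].
      by apply: (coef_in_monic_mul idJ1 mon_Hj (p := 0));
        rewrite ?size_poly0 ?size_poly_gt0 ?monic_neq0 ?subr0.
    apply: (@wreg_perturb _ _ _ _ (fun k => (h k)%:P) 'X) => //.
    + exact: ideal_coef_in.
    + by apply: ideal_add_mul; apply: ideal_coef_in.
    + by move=> a Ia; apply: mul_add_mul => //; apply: ideal_coef_in.
    by rewrite (map_comp polyC h); apply: wreg_monic.
  (* (J0 + x I1[x]) / (J0 + x J1[x]) is I1[x] / J1[x] through division by x *)
  apply: (@wreg_rel _ _ _ _ _ _ (fun u v =>
    [/\ coef_in I1 u, coef_in2 J0 I1 v & forall k, J1 (u`_k - v`_k.+1)])) reg.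
  + move=> u Iu; exists ('X * u).
      by split=> [|k]; rewrite coefXM //=; apply: ideal0.
    split=> // [|k]; first by split=> [|k]; rewrite coefXM //=; apply: ideal0.
    by rewrite coefXM /= subrr; apply: ideal0.
  + move=> v [v0 v1]; pose u := \poly_(k < size v) v`_k.+1.
    have uE k : u`_k = v`_k.+1.
      by rewrite coef_poly; case: ltnP => // le_vk; rewrite nth_default // leqW.
    have Iu : coef_in I1 u by move=> k; rewrite uE.
    by exists u => //; split=> // k; rewrite uE subrr; apply: ideal0.
  + move=> u v u' v' [Iu Jv uv] [Iu' Jv' uv']; split.
    * exact: (idealB (ideal_coef_in idI1)).
    * exact: idealB.
    move=> k; rewrite !coefB.
    have -> : u`_k - u'`_k - (v`_k.+1 - v'`_k.+1) =
      (u`_k - v`_k.+1) - (u'`_k - v'`_k.+1) by ring.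
    exact: idealB.
  + move=> k u v [Iu Jv uv]; split.
    * exact: (idealM (ideal_coef_in idI1)).
    * exact: idealM.
    move=> i; rewrite !coefM [X in _ - X]big_ord_recr /= subnn opprD addrA.
    apply: (idealB idJ1); last by apply: (idealM idJ1); apply: J01; case: Jv.
    rewrite -sumrB; apply: (ideal_sum idJ1) => l _.
    by rewrite subSn ?leq_ord // -mulrBr; apply: idealM.
  + move=> u v [Iu [v0 v1] uv]; split=> [Ju|[_ Jv] k].
      split=> // k; rewrite -[v`_k.+1](subKr u`_k); apply: idealB => //.
    exact: (idealBr idJ1) (uv k) (Jv k).
(* (I0 + x I1[x]) / (J0 + x I1[x]) is I0 / J0 through the constant coefficient *)
apply: (@wreg_rel _ _ _ _ _ _ (fun u v => coef_in2 I0 I1 v /\ u = v`_0)) reg0.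
- move=> u Iu; exists u%:P; last split=> //.
  + by split=> [|k]; rewrite coefC //=; apply: ideal0.
  + by split=> [|k]; rewrite coefC //=; apply: ideal0.
  + by rewrite coefC.
- by move=> v [v0 v1]; exists v`_0; last split.
- by move=> u v u' v' [Iv ->] [Iv' ->]; split; rewrite ?coefB //; apply: idealB.
- move=> k u v [Iv ->]; split; first exact: idealM.
  by rewrite coefM big_ord1 H0.
- by move=> u v [[v0 v1] ->]; split=> [|[]].
Qed.

(** * Monomial ideals and complete homogeneous polynomials *)

Definition upd (T : Type) (a : nat -> T) (j : nat) (b : T) : nat -> T :=
  fun i => if i == j then b else a i.

(** Exponent vectors are functions on [nat] of which only the first [n] values are read, so they
    need no retyping when a variable is split off. *)
Fixpoint mcoef (R : comNzRingType) (n : nat) : mp R n -> (nat -> nat) -> R :=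
  match n return mp R n -> (nat -> nat) -> R with
  | 0 => fun f _ => f
  | n'.+1 => fun f e => mcoef (f : {poly mp R n'})`_(e n') e
  end.

Fixpoint mconst (R : comNzRingType) (n : nat) : R -> mp R n :=
  match n return R -> mp R n with
  | 0 => id
  | n'.+1 => fun c => (mconst n' c)%:P
  end.

Definition supp (e : nat -> nat) : nat -> bool := fun i => (0 < e i)%N.

Section Coefficients.
Variable R : comNzRingType.

Lemma eq_mcoef n (f : mp R n) e e' :
  (forall i, (i < n)%N -> e i = e' i) -> mcoef f e = mcoef f e'.
Proof.
elim: n f => //= n IHn f ee'; rewrite ee' //.
by apply: IHn => i lt_in; apply: ee'; apply: leqW.
Qed.

Lemma mcoef0 n e : mcoef (0 : mp R n) e = 0.
Proof. by elim: n => //= n IHn; rewrite coef0. Qed.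

Lemma mcoefD n (f g : mp R n) e : mcoef (f + g) e = mcoef f e + mcoef g e.
Proof. by elim: n f g => //= n IHn f g; rewrite coefD IHn. Qed.

Lemma mcoef_sum n (T : finType) (P : pred T) (F : T -> mp R n) e :
  mcoef (\sum_(t | P t) F t) e = \sum_(t | P t) mcoef (F t) e.
Proof.
apply: (big_morph (fun f => mcoef f e)) => [f g|]; first exact: mcoefD.
exact: mcoef0.
Qed.

Lemma mcoef_mconstM n c (f : mp R n) e : mcoef (mconst n c * f) e = c * mcoef f e.
Proof. by elim: n f => //= n IHn f; rewrite coefCM IHn. Qed.

Lemma mconst_is_zmod_morphism n : zmod_morphism (@mconst R n).
Proof. by elim: n => //= n IHn c c'; rewrite IHn polyCB. Qed.

Lemma mconst_is_monoid_morphism n : monoid_morphism (@mconst R n).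
Proof.
elim: n => //= n [IH1 IHM]; split=> [|c c']; first by rewrite IH1.
by rewrite IHM polyCM.
Qed.

HB.instance Definition _ n :=
  GRing.isZmodMorphism.Build R (mp R n) (@mconst R n) (mconst_is_zmod_morphism n).
HB.instance Definition _ n :=
  GRing.isMonoidMorphism.Build R (mp R n) (@mconst R n)
    (mconst_is_monoid_morphism n).

Lemma mcoef_mvarM n j (f : mp R n) e : (j < n)%N ->
  mcoef (mvar R n j * f) e = if e j is k.+1 then mcoef f (upd e j k) else 0.
Proof.
elim: n f => //= n IHn f; rewrite ltnS leq_eqVlt.
case: eqVneq => [-> _|ne_jn /= lt_jn].
  rewrite coefXM; case: (e n) => [|k] /=; first exact: mcoef0.
  rewrite /upd eqxx; apply: eq_mcoef => i lt_in.
  by rewrite /upd ltn_eqF.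
rewrite coefCM IHn //; case: (e j) => // k.
by rewrite [in RHS]/upd eq_sym (negPf ne_jn).
Qed.

Lemma prod_mvar_rec n (a : nat -> bool) :
  \prod_(i < n.+1 | a i) mvar R n.+1 i =
  (\prod_(i < n | a i) mvar R n i)%:P * 'X^(a n) :> {poly mp R n}.
Proof.
rewrite big_mkcond big_ord_recr /= eqxx rmorph_prod /= [in RHS]big_mkcond /=.
congr (_ * _); last by case: (a n); rewrite ?expr1 ?expr0.
by apply: eq_bigr => i _; rewrite ltn_eqF.
Qed.

Lemma mcoef_prod_mvar n (a : nat -> bool) :
  mcoef (\prod_(i < n | a i) mvar R n i) (fun i => a i) = 1.
Proof.
elim: n => [|n IHn]; first by rewrite big_ord0.
by rewrite prod_mvar_rec /= coefCM coefXn eqxx mulr1.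
Qed.

End Coefficients.

Definition monotone (F : (nat -> bool) -> bool) : Prop :=
  forall a b : nat -> bool, (forall i, a i -> b i) -> F a -> F b.

(** With x the variable of index [n], [b = false] describes the part of the ideal free of x, and
    [b = true] the colon ideal by x, restricted to the first [n] variables. *)
Definition fixvar (F : (nat -> bool) -> bool) n b : (nat -> bool) -> bool :=
  fun a => F (upd a n b).

Lemma monotone_fixvar F n b : monotone F -> monotone (fixvar F n b).
Proof.
by move=> monF a a' aa'; apply: monF => i; rewrite /upd; case: eqP => // _; apply: aa'.
Qed.

(* The squarefree monomial ideal spanned by the monomials whose support
   satisfies the monotone predicate [F]. *)
Definition sqfree (R : comNzRingType) n F (f : mp R n) : Prop :=
  forall e, mcoef f e != 0 -> F (supp e).

Section Sqfree.
Variable R : comNzRingType.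

(** Membership depends only on supports, so all positive powers of the last variable impose the same
    condition and two coefficient ideals suffice. *)
Lemma sqfree_rec n F (f : mp R n.+1) : monotone F ->
  @sqfree R n.+1 F f <->
  coef_in2 (@sqfree R n (fixvar F n false)) (@sqfree R n (fixvar F n true)) f.
Proof.
move=> monF; split=> [Ff|[Ff0 Ff1] e].
  have Ffk k : @sqfree R n (fixvar F n (0 < k)%N) (f : {poly mp R n})`_k.
    move=> e nz; apply: monF (Ff (upd e n k) _) => [i|/=].
      by rewrite /supp /upd; case: ifP.
    rewrite {1}/upd eqxx; apply: contraNneq nz => <-; apply/eqP/eq_mcoef => i lt_in.
    by rewrite /upd ltn_eqF.
  by split=> [|k]; [apply: (Ffk 0%N) | apply: (Ffk k.+1)].
move=> /= nz; apply: (monF (upd (supp e) n (0 < e n)%N)).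
  by move=> i; rewrite /upd; case: eqP => // ->.
by move: nz; case: (e n) => [|k] /=; [apply: Ff0 | apply: Ff1].
Qed.

Lemma sqfree_sub n (F F' : (nat -> bool) -> bool) (f : mp R n) :
  (forall a, F a -> F' a) -> sqfree F f -> sqfree F' f.
Proof. by move=> FF' Ff e nz; apply/FF'/Ff. Qed.

Lemma fixvar_sub n F : monotone F ->
  forall f : mp R n, sqfree (fixvar F n false) f -> sqfree (fixvar F n true) f.
Proof.
move=> monF f; apply: sqfree_sub => a; apply: monF => i.
by rewrite /upd; case: eqP.
Qed.

Lemma ideal_sqfree n F : monotone F -> is_ideal (@sqfree R n F).
Proof.
elim: n F => [|n IHn] F monF.
  split=> [e|u v Fu Fv e|a u Fu e] /=; first by rewrite eqxx.
    have [->|u0 _] := eqVneq u 0; last exact: (Fu e).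
    by rewrite add0r; apply: (Fv e).
  by have [->|u0 _] := eqVneq u 0; [rewrite mulr0 eqxx | apply: (Fu e)].
have [H0 HD HM] := ideal_coef_in2 (IHn _ (@monotone_fixvar _ n false monF))
  (IHn _ (@monotone_fixvar _ n true monF)) (fixvar_sub monF).
split=> [|u v Fu Fv|a u Fu]; apply/sqfree_rec => //.
  by apply: HD; apply/sqfree_rec.
by apply: HM; apply/sqfree_rec.
Qed.

Lemma sqfree_ind n (F : (nat -> bool) -> bool) (Q : mp R n -> Prop) : is_ideal Q ->
  (forall a : nat -> bool, F a -> Q (\prod_(i < n | a i) mvar R n i)) ->
  monotone F -> forall f, sqfree F f -> Q f.
Proof.
elim: n F Q => [|n IHn] F Q idQ QF monF f Ff.
  have [->|f0] := eqVneq f 0; first exact: ideal0.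
  have := QF (supp (fun=> 0%N)) (Ff (fun=> 0%N) f0); rewrite big_ord0 => Q1.
  by rewrite -[f]mulr1; apply: (idealM idQ).
(* The slices of [Q] at exponents 0 and 1 of the last variable are ideals in one variable fewer. *)
pose Qb b (g : mp R n) := Q (g%:P * 'X^b).
have idQb b : is_ideal (Qb b).
  split=> [|u v Qu Qv|a u Qu]; rewrite /Qb.
  - by rewrite polyC0 mul0r; apply: ideal0.
  - by rewrite polyCD mulrDl; apply: (idealD idQ).
  - by rewrite polyCM -mulrA; apply: (idealM idQ).
have step (b : bool) (g : mp R n) : sqfree (fixvar F n b) g -> Q (g%:P * 'X^b).
  apply: (IHn _ (Qb b) (idQb b)); last exact: monotone_fixvar.
  move=> a Fa; have := QF _ Fa; rewrite prod_mvar_rec {2}/upd eqxx /Qb.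
  congr (Q (_%:P * _)); apply: eq_bigl => i; by rewrite /upd ltn_eqF.
have [Ff0 Ff1] := (sqfree_rec (f : mp R n.+1) monF).1 Ff.
rewrite -[f](@coefK (mp R n)) poly_def; apply: (ideal_sum idQ) => k _.
rewrite -mul_polyC; case: (val k) => [|k']; first exact: (step false).
(* All but one factor of the power is absorbed by the ideal [Q], leaving exponent 1. *)
rewrite exprS mulrA mulrC; apply: (idealM idQ).
by apply: (step true); apply: Ff1.
Qed.

End Sqfree.

(** The complete homogeneous symmetric polynomial of degree [k], sorted by the exponent of the last
    variable. *)
Fixpoint hsym (R : comNzRingType) (n k : nat) : mp R n :=
  match n return mp R n with
  | 0 => (k == 0)%:R
  | n'.+1 => \poly_(i < k.+1) hsym R n' (k - i)
  end.

Section CompleteHomogeneous.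
Variable R : comNzRingType.

Lemma hsym_0 n : hsym R n 0 = 1.
Proof.
elim: n => //= n IHn; apply/polyP => i; rewrite coef_poly coef1.
by case: i => //=; rewrite IHn.
Qed.

Lemma coef0_hsym n k : (hsym R n.+1 k : {poly mp R n})`_0 = hsym R n k.
Proof. by rewrite coef_poly subn0. Qed.

Lemma hsym_rec n k :
  hsym R n.+1 k.+1 = (hsym R n k.+1)%:P + 'X * hsym R n.+1 k :> {poly mp R n}.
Proof.
apply/polyP => i; rewrite coefD coefC coefXM !coef_poly ltnS.
by case: i => [|i] /=; rewrite ?addr0 ?subn0 // add0r subSS.
Qed.

Lemma monic_hsym n k : (hsym R n.+1 k : {poly mp R n}) \is monic.
Proof.
rewrite monicE /= lead_coefE coefE.
have sz : size (\poly_(i < k.+1) hsym R n (k - i)) = k.+1.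
  by apply: size_poly_eq; rewrite subnn hsym_0 oner_neq0.
by rewrite sz /= leqnn subnn hsym_0.
Qed.

Lemma wreg_hsym n (FI FJ : (nat -> bool) -> bool) d j :
  monotone FI -> monotone FJ -> (forall a, FJ a -> FI a) ->
  (forall a, FI a -> ~~ FJ a -> (d <= \sum_(i < n) a i)%N) ->
  wreg (@sqfree R n FI) (@sqfree R n FJ) [seq hsym R n k | k <- iota j d].
Proof.
elim: n FI FJ d j => [|n IHn] FI FJ [//|d] j monI monJ JI deg.
  (* Without variables every degree is 0, so a positive [d] leaves nothing in I outside J. *)
  apply: wreg_sub; [|exact: ideal_sqfree|exact: ideal_sqfree].
  move=> u; apply: sqfree_sub => a Ia; apply: contraT => nJa.
  by have := deg a Ia nJa; rewrite big_ord0.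
pose Ib b := @sqfree R n (fixvar FI n b); pose Jb b := @sqfree R n (fixvar FJ n b).
have JbIb b u : Jb b u -> Ib b u by apply: sqfree_sub => a; apply: JI.
have sum_upd a (b : bool) :
    (\sum_(i < n.+1) upd a n b i = \sum_(i < n) a i + b)%N.
  rewrite big_ord_recr /= {2}/upd eqxx; congr (_ + _)%N.
  by apply: eq_bigr => i _; rewrite /upd ltn_eqF.
have reg : wreg (coef_in2 (Ib false) (Ib true)) (coef_in2 (Jb false) (Jb true))
    [seq hsym R n.+1 k | k <- iota j d.+1].
  (* Removing the last variable from a monomial keeps the degree bound if the variable is absent and
     lowers it by one if present, exactly the two lengths required. *)
  apply: (wreg_coef_in2 (h := hsym R n));
    try (by apply: ideal_sqfree; apply: monotone_fixvar);
    try exact: fixvar_sub; try exact: JbIb.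
  - exact: coef0_hsym.
  - exact: hsym_rec.
  - exact: monic_hsym.
  - apply: IHn => [||a|a Ia nJa]; try exact: monotone_fixvar; first exact: JI.
    by have := deg _ Ia nJa; rewrite sum_upd addn0.
  - apply: IHn => [||a|a Ia nJa]; try exact: monotone_fixvar; first exact: JI.
    by have := deg _ Ia nJa; rewrite sum_upd addn1 ltnS.
by apply: eq_wreg reg => u; apply: iff_sym; apply: sqfree_rec.
Qed.

End CompleteHomogeneous.

(** * The Koszul complex *)

Section Koszul.
Variables (R : comNzRingType) (n : nat) (x : 'I_n -> R).
Implicit Types (A : {set 'I_n}) (c : {set 'I_n} -> R) (j l : 'I_n).

Definition ksign j A : R := (-1) ^+ #|[set i in A | (i < j)%N]|.

(** The coboundary on cochains of all degrees at once, the degree being the cardinality of the index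
    set; [contract] is contraction in the opposite direction. *)
Definition koszul c A : R := \sum_(j in A) ksign j A * x j * c (A :\ j).

Definition contract (g : 'I_n -> R) c A : R :=
  \sum_(j in ~: A) ksign j A * g j * c (j |: A).

Lemma ksignD1 j l A : l \in A -> ksign j A = (-1) ^+ (l < j)%N * ksign j (A :\ l).
Proof.
move=> Al; rewrite /ksign (cardsD1 l) !inE Al /= exprD; congr (_ * _ ^+ _).
by apply: eq_card => i; rewrite !inE andbA.
Qed.

Lemma ksignU1 j l A : l \notin A ->
  ksign j (l |: A) = (-1) ^+ (l < j)%N * ksign j A.
Proof. by move=> nAl; rewrite (ksignD1 j (setU11 l A)) setU1K. Qed.

Lemma ksign_self j A : ksign j (A :\ j) = ksign j A.
Proof.
congr (_ ^+ _); apply: eq_card => i; rewrite !inE.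
by case: eqVneq => //= ->; rewrite ltnn andbF.
Qed.

Lemma ksign_sq j A : ksign j A * ksign j A = 1.
Proof. by rewrite -expr2 sqrr_sign. Qed.

(** Removing two indices in either order leaves the same set, with opposite signs. *)
Lemma koszulK c A : koszul (koszul c) A = 0.
Proof.
pose F j l := ksign j A * x j * (ksign l (A :\ j) * x l * c (A :\ j :\ l)).
have FN j l : j \in A -> l \in A -> (j < l)%N -> F j l = - F l j.
  move=> Aj Al lt_jl; rewrite /F.
  have -> : A :\ j :\ l = A :\ l :\ j.
    by apply/setP => i; rewrite !inE andbCA.
  rewrite (ksignD1 l Aj) (ksignD1 j Al) lt_jl ltnNge ltnW //= expr0 expr1.
  ring.
have -> : koszul (koszul c) A =
    \sum_(j in A) \sum_(l in A | (j < l)%N) F j l +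
    \sum_(j in A) \sum_(l in A | (l < j)%N) F j l.
  rewrite -big_split /=; apply: eq_bigr => j Aj.
  rewrite /koszul mulr_sumr (bigID (fun l : 'I_n => (j < l)%N)) /=.
  congr (_ + _); apply: eq_bigl => l; rewrite in_setD1.
    by case: (eqVneq l j) => [->|] //=; rewrite ltnn andbF.
  by case: (ltngtP l j) => [||/val_inj ->] //=; rewrite ?eqxx ?andbF ?andbT //;
    case: eqVneq => // ->; rewrite ltnn.
rewrite [X in _ + X](exchange_big_dep (mem A)) /=; last by move=> j l _ /andP[].
rewrite -big_split big1 //= => j Aj; apply/eqP; rewrite addr_eq0 -sumrN.
apply/eqP; apply: eq_big => [l|l /andP[Al lt_jl]]; first by rewrite Aj.
exact: FN.
Qed.

(** The terms that remove and restore the same index give the right-hand side, split according to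
    whether the index lies in [A]; the mixed terms cancel in pairs. *)
Lemma koszul_contract g c A :
  koszul (contract g c) A + contract g (koszul c) A =
  (\sum_j g j * x j) * c A.
Proof.
pose F j l := ksign j A * x j * (ksign l (A :\ j) * g l * c (l |: (A :\ j))).
have -> : koszul (contract g c) A = \sum_(j in A) g j * x j * c A
    + \sum_(j in A) \sum_(l in ~: A) F j l.
  rewrite -big_split; apply: eq_bigr => j Aj /=.
  rewrite /contract (bigD1 j) /= ?inE ?eqxx // mulrDr; congr (_ + _).
    rewrite ksign_self setD1K //.
    have -> : ksign j A * x j * (ksign j A * g j * c A) =
      (ksign j A * ksign j A) * (g j * x j * c A) by ring.
    by rewrite ksign_sq mul1r.
  rewrite mulr_sumr; apply: eq_bigl => l; rewrite !inE negb_and negbK.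
  by case: eqVneq => [->|] //=; rewrite ?Aj ?andbF // andbT.
have -> : contract g (koszul c) A = \sum_(l in ~: A) g l * x l * c A
    - \sum_(l in ~: A) \sum_(j in A) F j l.
  rewrite -sumrB; apply: eq_bigr => l; rewrite inE => nAl.
  rewrite /koszul (big_setU1 _ nAl) mulrDr -sumrN mulr_sumr /=; congr (_ + _).
    rewrite setU1K // ksignU1 // ltnn mul1r.
    have -> : ksign l A * g l * (ksign l A * x l * c A) =
      (ksign l A * ksign l A) * (g l * x l * c A) by ring.
    by rewrite ksign_sq mul1r.
  apply: eq_bigr => j Aj; rewrite /F.
  have ne_jl : j != l by apply: contraNneq nAl => <-.
  have -> : (l |: A) :\ j = l |: (A :\ j).
    apply/setP => i; rewrite !inE.
    by case: (eqVneq i l) => [->|]; rewrite //= eq_sym ne_jl.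
  rewrite ksignU1 // (ksignD1 l Aj).
  case: (ltngtP j l) ne_jl => [||/val_inj ->]; rewrite ?eqxx // => _ _; ring.
rewrite exchange_big addrACA addrN addr0 mulr_suml.
rewrite [RHS](bigID (mem A)) /=; congr (_ + _).
by apply: eq_bigl => j; rewrite inE.
Qed.

(* Contraction by the coefficients of f in the [x j] is a homotopy between
   multiplication by f and 0, so Koszul cohomology vanishes below the depth. *)
Lemma koszul_exact (I J : R -> Prop) (fs : seq R) p c :
  is_ideal I -> is_ideal J ->
  (forall f, f \in fs -> exists g : 'I_n -> R, f = \sum_j g j * x j) ->
  wreg I J fs -> (p < size fs)%N -> (forall A, I (c A)) ->
  (forall A, #|A| = p.+1 -> J (koszul c A)) ->
  exists2 w, forall A, I (w A) & forall A, #|A| = p -> J (c A - koszul w A).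
Proof.
move=> idI; elim: fs p J c => [|f fs IHfs] // p J c idJ fsP [nzd reg] lt_p Ic Jc.
have [g Df] := fsP f (mem_head f fs).
have fsP' f' : f' \in fs -> exists g : 'I_n -> R, f' = \sum_j g j * x j.
  by move=> fs_f'; apply: fsP; rewrite inE fs_f' orbT.
have idJ' := ideal_add_mul idI idJ f.
have Jkc A : #|A| = p -> J (f * c A - koszul (contract g c) A).
  move=> cardA; rewrite Df -koszul_contract addrAC subrr add0r.
  apply: (ideal_sum idJ) => j; rewrite inE => nAj; apply: (idealM idJ).
  by apply: Jc; rewrite cardsU1 nAj cardA.
(* In degree 0 there are no coboundaries: [f] times the value at the empty set lies in J, and
   regularity of [f] concludes. *)
case: p lt_p Jc Jkc => [|p] lt_p Jc Jkc.
  exists (fun=> 0) => [A|A /eqP]; first exact: ideal0.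
  rewrite cards_eq0 => /eqP ->; rewrite /koszul big_set0 subr0.
  by apply: nzd => //; have := Jkc _ (cards0 _); rewrite /koszul big_set0 subr0.
have Isc A : I (contract g c A).
  by apply: (ideal_sum idI) => j _; apply: (idealM idI).
(* The coboundary of [contract g c] is [f * c] modulo J, so [contract g c] is a cocycle modulo J + f
   I, one degree lower, for the shorter sequence. *)
have [|w Iw Jw] := IHfs p _ (contract g c) idJ' fsP' reg lt_p Isc.
  move=> A cardA; exists (c A) => //.
  by rewrite -opprB; apply: (idealN idJ); apply: Jkc.
(* [v] is the correction by which [contract g c] and [koszul w] differ modulo J, after division by
   [f]; it is set to 0 on sets of other sizes. *)
have /fin_all_exists [v Hv] : forall A, exists a,
    I a /\ (#|A| = p -> J (contract g c A - koszul w A - f * a)).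
  move=> A; have [cardA|] := eqVneq #|A| p; last first.
    by move=> neA; exists 0; split=> [|/eqP]; [exact: ideal0 | rewrite (negPf neA)].
  by have [a Ia Ja] := Jw A cardA; exists a.
exists v => [A|A cardA]; first by case: (Hv A).
apply: nzd.
  apply: (idealB idI) => //.
  by apply: (ideal_sum idI) => j _; apply: (idealM idI); case: (Hv (A :\ j)).
(* Taking coboundaries of that congruence kills [koszul w], so [f * c] and [f * koszul v] agree
   modulo J, and [f] can be cancelled. *)
have -> : f * (c A - koszul v A) = (f * c A - koszul (contract g c) A) +
    koszul (fun B => contract g c B - koszul w B - f * v B) A.
  have -> : koszul (fun B => contract g c B - koszul w B - f * v B) A =
      koszul (contract g c) A - koszul (koszul w) A - f * koszul v A.
    rewrite /koszul mulr_sumr -!sumrB; apply: eq_bigr => j _; ring.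
  by rewrite koszulK; ring.
apply: (idealD idJ); first exact: Jkc.
apply: (ideal_sum idJ) => j Aj; apply: (idealM idJ).
case: (Hv (A :\ j)) => _; apply.
by have := cardsD1 j A; rewrite Aj cardA => -[].
Qed.

End Koszul.

(** * Matchings and Stanley partitions *)

(* A matrix with trivial row kernel has a nonzero maximal minor, and a nonzero
   term of its Leibniz expansion is a matching. *)
Lemma matching_or_kernel (K : fieldType) (T : finType) (X Y : {set T})
    (e : T -> T -> K) :
  (exists m : T -> T, {in X &, injective m} /\
     forall A, A \in X -> m A \in Y /\ e A (m A) != 0) \/
  (exists z : T -> K, [/\ exists2 A, A \in X & z A != 0,
     forall A, A \notin X -> z A = 0 &
     forall B, B \in Y -> \sum_(A in X) z A * e A B = 0]).
Proof.
have [->|[x0 X0]] := set_0Vmem X.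
  by left; exists id; split=> [A B|A]; rewrite inE.
pose M : 'M[K]_(#|X|, #|Y|) := \matrix_(i, j) e (enum_val i) (enum_val j).
have [freeM|] := boolP (row_free M); [left | rewrite -kermx_eq0 => ker; right].
  have fullM : row_full M^T by rewrite /row_full mxrank_tr.
  pose f := fullrankfun fullM; pose N := rowsub f M^T.
  have unitN : N \in unitmx by rewrite -row_full_unit fullrowsub_full.
  have [s nz_s] : exists s : {perm 'I_#|X|}, \prod_i N i (s i) != 0.
    apply/existsP; apply: contraLR unitN => /existsPn nz.
    rewrite unitmxE unitfE negbK; apply/eqP; rewrite /determinant big1 // => s _.
    by have := nz s; rewrite negbK => /eqP ->; rewrite mulr0.
  (* The nonzero term pairs row [s i] of [M] with column [f i], so the index belonging to [A] is
     found by inverting [s]. *)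
  pose r A := (s^-1)%g (enum_rank_in X0 A).
  have rK A : A \in X -> enum_val (s (r A)) = A.
    by move=> XA; rewrite permKV enum_rankK_in.
  exists (fun A => enum_val (f (r A))); split=> [A B XA XB|A XA].
    by move=> /enum_val_inj/fullrankfun_inj eq_r; rewrite -(rK A) // eq_r rK.
  split; first exact: enum_valP.
  by move: nz_s => /prodf_neq0/(_ (r A) isT); rewrite !mxE rK.
have [v /sub_kermxP vM v0] := rowV0Pn ker.
have [i vi] := rV0Pn _ v0.
exists (fun A => if A \in X then v ord0 (enum_rank_in X0 A) else 0); split.
- by exists (enum_val i); rewrite ?enum_valP // enum_valK_in.
- by move=> A /negPf ->.
move=> B YB; have /rowP/(_ (enum_rank_in YB B)) := vM.
rewrite !mxE => vM0; rewrite -[RHS]vM0 big_enum_val; apply: eq_bigr => k _.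
by rewrite !mxE enum_valP enum_valK_in enum_rankK_in.
Qed.

(** * Up-sets of supports and monomial ideals *)

Definition ind n (A : {set 'I_n}) : nat -> bool :=
  fun i => [exists j in A, val j == i].

(** The monotone predicate of the ideal generated by [G], as [in_midealP] confirms. *)
Definition up n (G : {set {set 'I_n}}) (a : nat -> bool) : bool :=
  [exists B in G, [forall i in B, a (val i)]].

Section UpSets.
Variable n : nat.
Implicit Types (A B : {set 'I_n}) (G : {set {set 'I_n}}) (j : 'I_n).

Lemma indE A j : ind A j = (j \in A).
Proof.
apply/existsP/idP => [[i /andP[Ai /eqP/val_inj <-]] // | Aj].
by exists j; rewrite Aj /=.
Qed.

Lemma upP G (a : nat -> bool) :
  reflect (exists2 B, B \in G & forall i, i \in B -> a (val i)) (up G a).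
Proof.
apply: (iffP existsP) => [[B /andP[GB /forall_inP aB]]|[B GB aB]]; exists B => //.
by rewrite GB; apply/forall_inP.
Qed.

Lemma monotone_up G : monotone (up G).
Proof.
by move=> a b ab /upP[B GB aB]; apply/upP; exists B => // i /aB/ab.
Qed.

Lemma up_ind G (a : nat -> bool) : up G (ind [set i : 'I_n | a i]) = up G a.
Proof.
by apply/upP/upP => -[B GB aB]; exists B => // i /aB; rewrite indE inE.
Qed.

Lemma up_indS G A B : A \subset B -> up G (ind A) -> up G (ind B).
Proof.
move=> /subsetP sAB /upP[C GC aC]; apply/upP; exists C => // i /aC.
by rewrite !indE; apply: sAB.
Qed.

Lemma up_leq G d a : (forall B, B \in G -> (d <= #|B|)%N) -> up G a ->
  (d <= \sum_(i < n) a i)%N.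
Proof.
move=> degG /upP[B GB aB]; apply: leq_trans (degG B GB) _.
rewrite -sum1_card big_mkcond /=; apply: leq_sum => i _.
by case: ifP => // /aB ->.
Qed.

Lemma sum_ind A : (\sum_(i < n) ind A i)%N = #|A|.
Proof.
rewrite -sum1_card [RHS]big_mkcond; apply: eq_bigr => i _.
by rewrite indE; case: (i \in A).
Qed.

Lemma up_leq_card G d A : (forall B, B \in G -> (d <= #|B|)%N) -> up G (ind A) ->
  (d <= #|A|)%N.
Proof. by move=> degG /(up_leq degG); rewrite sum_ind. Qed.

End UpSets.

Section MonomialIdeals.
Variables (R : comNzRingType) (n : nat).
Implicit Types (A B : {set 'I_n}) (G : {set {set 'I_n}}).

Lemma sqmonE A : sqmon R A = \prod_(i < n | ind A i) mvar R n i.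
Proof. by apply: eq_bigl => i; rewrite indE. Qed.

Lemma sqmonD1 A (j : 'I_n) : j \in A -> sqmon R A = mvar R n j * sqmon R (A :\ j).
Proof. by move=> Aj; rewrite /sqmon (big_setD1 j). Qed.

Lemma mcoef_sqmon A : mcoef (sqmon R A) (fun i => ind A i) = 1.
Proof. by rewrite sqmonE mcoef_prod_mvar. Qed.

Lemma mcoef_sqmon_neq0 A e : mcoef (sqmon R A) e != 0 ->
  forall j, j \in A -> supp e (val j).
Proof.
move=> nz j Aj; move: nz; rewrite (sqmonD1 Aj) mcoef_mvarM // /supp.
by case: (e j) => //; rewrite eqxx.
Qed.

Lemma ideal_in_mideal G : is_ideal (@in_mideal R n G).
Proof.
split=> [|u v [c ->] [c' ->]|a u [c ->]].
- by exists (fun=> 0); rewrite big1 // => B _; rewrite mul0r.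
- exists (fun B => c B + c' B); rewrite -big_split.
  by apply: eq_bigr => B _; rewrite mulrDl.
- exists (fun B => a * c B); rewrite mulr_sumr.
  by apply: eq_bigr => B _; rewrite mulrA.
Qed.

Lemma in_midealP G f : @in_mideal R n G f <-> sqfree (up G) f.
Proof.
split=> [[c ->]|].
  have idG := ideal_sqfree R n (@monotone_up n G).
  apply: (ideal_sum idG) => B GB; apply: (idealM idG) => e /mcoef_sqmon_neq0 eB.
  by apply/upP; exists B.
apply: sqfree_ind; [exact: ideal_in_mideal | | exact: monotone_up].
move=> a /upP[B GB aB].
(* All of the cofactor is placed on one generator [B] that divides the monomial. *)
exists (fun C => if C == B then \prod_(i < n | a i && (i \notin B)) mvar R n i else 0).
rewrite (bigD1 B) //= eqxx [X in _ + X]big1 ?addr0; last first.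
  by move=> C /andP[_ /negPf ->]; rewrite mul0r.
rewrite (bigID (mem B)) /= mulrC; congr (_ * _).
by apply: eq_bigl => i; case: (boolP (i \in B)) => [/aB ->|]; rewrite ?andbF.
Qed.

Lemma in_mideal_prod G (a : nat -> bool) :
  in_mideal G (\prod_(i < n | a i) mvar R n i) <-> up G a.
Proof.
split=> [/in_midealP/(_ (fun i => a i))|/upP[B GB aB]].
  rewrite mcoef_prod_mvar oner_neq0 => /(_ isT); apply: monotone_up => i.
  by rewrite /supp lt0b.
apply/in_midealP => e nz; apply/upP; exists B => // i /aB ai.
move: nz; rewrite (bigD1 i) //= mcoef_mvarM // /supp.
by case: (e i) => //; rewrite eqxx.
Qed.

Lemma in_mideal_sqmon G A : in_mideal G (sqmon R A) <-> up G (ind A).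
Proof. by rewrite sqmonE; apply: in_mideal_prod. Qed.

(** The monomial would have to come from [A :\ j] in [w], whose degree is below that of every
    generator. Through this, the generation of I in degrees at least [d] makes products of I with
    the maximal ideal vanish in degree [d]. *)
Lemma mcoef_mvarM_mideal G A (j : 'I_n) w :
  (forall B, B \in G -> (#|A| <= #|B|)%N) -> in_mideal G w ->
  mcoef (mvar R n j * w) (fun i => ind A i) = 0.
Proof.
move=> degG /in_midealP Gw; rewrite mcoef_mvarM // indE.
case: (boolP (j \in A)) => //= Aj; apply: contraTeq isT => /Gw.
have sub : up G (supp (upd (fun i => ind A i : nat) j 0%N)) -> up G (ind (A :\ j)).
  apply: monotone_up => i; rewrite /supp /upd; case: eqVneq => //.
  rewrite lt0b => ne_ij /existsP[k /andP[Ak /eqP Dk]].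
  apply/existsP; exists k; rewrite !inE Ak Dk eqxx !andbT.
  by apply: contraNneq ne_ij => <-; rewrite -Dk.
by move=> /sub/(up_leq_card degG); rewrite (cardsD1 j A) Aj ltnn.
Qed.

Lemma in_maxideal_hsym k : @in_maxideal R n (hsym R n k.+1).
Proof.
elim: n => [|m [c Dc]]; first by exists (fun=> 0); rewrite big_ord0.
exists (fun i => if unlift ord_max i is Some i' then (c i')%:P else hsym R m.+1 k).
rewrite hsym_rec big_ord_recr /= eqxx unlift_none mulrC; congr (_ + _).
rewrite Dc rmorph_sum; apply: eq_bigr => i _ /=.
have -> : widen_ord (leqnSn m) i = lift ord_max i by exact/val_inj/esym/lift_max.
by rewrite liftK ltn_eqF // rmorphM.
Qed.

End MonomialIdeals.

(** * The poset of squarefree monomials in I \ J and its partitions *)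

Definition poset n (GI GJ : {set {set 'I_n}}) : {set {set 'I_n}} :=
  [set A | up GI (ind A) && ~~ up GJ (ind A)].

Definition level n (GI GJ : {set {set 'I_n}}) k : {set {set 'I_n}} :=
  [set A in poset GI GJ | #|A| == k].

Lemma inPP (R : comNzRingType) n (GI GJ : {set {set 'I_n}}) A :
  inP R GI GJ A <-> A \in poset GI GJ.
Proof.
rewrite /inP inE; split=> [[/in_mideal_sqmon -> nJ]|/andP[/in_mideal_sqmon IA nJ]].
  by apply/negP => /(in_mideal_sqmon R).
by split=> // /in_mideal_sqmon; apply/negP.
Qed.

(** Each [A] of degree [d] spans the interval from [A] to [m A], which has only these two elements;
    every remaining monomial has degree above [d] and forms an interval alone. *)
Lemma matching_partition (R : comNzRingType) n (GI GJ : {set {set 'I_n}}) d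
    (m : {set 'I_n} -> {set 'I_n}) :
  (forall A, A \in poset GI GJ -> (d <= #|A|)%N) ->
  (exists A, A \in poset GI GJ) ->
  {in level GI GJ d &, injective m} ->
  (forall A, A \in level GI GJ d -> m A \in level GI GJ d.+1 /\ A \subset m A) ->
  exists2 Pt, stanley_partition R GI GJ Pt & (d < sdepth_part Pt)%N.
Proof.
move=> degP [A0 PA0] inj_m mP; set P := poset GI GJ in degP PA0 *.
have levelP k A : reflect (A \in P /\ #|A| = k) (A \in level GI GJ k).
  by apply: (iffP setIdP) => -[PA cA]; split=> //; apply/eqP.
set X := level GI GJ d in inj_m mP *.
pose S := [set B in P | (d < #|B|)%N && (B \notin m @: X)].
pose Pt := [set (A, m A) | A in X] :|: [set (B, B) | B in S].
have PtP p : p \in Pt ->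
    (exists2 A, A \in X & p = (A, m A)) \/ (exists2 B, B \in S & p = (B, B)).
  by rewrite inE => /orP[] /imsetP[A ? ->]; [left | right]; exists A.
have card_m A : A \in X -> #|m A| = d.+1 by case/mP => /levelP[].
have card_X A : A \in X -> #|A| = d by case/levelP.
have between (A W : {set 'I_n}) :
    A \in X -> A \subset W -> W \subset m A -> W = A \/ W = m A.
  move=> XA sAW sWm; have := subset_leq_card sWm; rewrite card_m // leq_eqVlt.
  case/orP => [cW|]; first by right; apply/eqP; rewrite eqEcard sWm card_m //= (eqP cW).
  by rewrite ltnS -(card_X A XA) => cW; left; apply/esym/eqP; rewrite eqEcard sAW.
have mixed (A B W : {set 'I_n}) :
    A \in X -> B \in S -> A \subset W -> W \subset m A -> W != B.
  move=> XA; rewrite inE => /and3P[_ lt_dB nmB] sAW sWm.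
  apply: contraNneq nmB => DW; rewrite -DW in lt_dB *.
  case: (between A W XA sAW sWm) => [DA|->]; last exact: imset_f.
  by rewrite DA card_X ?ltnn in lt_dB.
exists Pt; first split.
- move=> p /PtP[] [A XA ->] /=; split=> //.
  + by apply/inPP; case/levelP: XA.
  + by apply/inPP; case: (mP A XA) => /levelP[].
  + by case: (mP A XA).
  + by apply/inPP; case/setIdP: XA.
  + by apply/inPP; case/setIdP: XA.
- move=> p q W /PtP[] [A XA ->] /PtP[] [B XB ->] [_ /= [sAW sWA]] [_ /= [sBW sWB]].
  + case: (between A W XA sAW sWA) => DW.
      have sBA : B \subset A by rewrite -DW.
      by suff /eqP -> : B == A by []; rewrite eqEcard sBA !card_X /=.
    case: (between B W XB sBW sWB) => DW'.
      by have := card_m A XA; rewrite -DW DW' card_X // => /n_Sn.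
    by have -> : A = B by apply: inj_m => //; rewrite -DW -DW'.
  + have /eqP[] := mixed A B W XA XB sAW sWA.
    by apply/eqP; rewrite eqEsubset sWB.
  + have /eqP[] := mixed B A W XB XA sBW sWB.
    by apply/eqP; rewrite eqEsubset sWA.
  + have -> : A = W by apply/eqP; rewrite eqEsubset sAW.
    by have -> : B = W by apply/eqP; rewrite eqEsubset sBW.
- move=> W PW; have /inPP PW' := PW; have := degP W PW'; rewrite leq_eqVlt.
  case/orP => [/eqP cW|lt_dW].
    have XW : W \in X by apply/levelP.
    exists (W, m W); first by rewrite inE imset_f.
    by split=> //=; split=> //; case: (mP W XW).
  have [/imsetP[A XA DW]|nW] := boolP (W \in m @: X).
    exists (A, m A); first by rewrite inE imset_f.
    by split=> //=; rewrite DW; split=> //; case: (mP A XA).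
  exists (W, W); last by [].
  by rewrite inE orbC imset_f // inE PW' lt_dW nW.
apply: (big_ind (fun k => (d < k)%N)) => [|a b lt_a lt_b|p /PtP[] [A XA ->] /=].
(* The default value [n] of the minimum must exceed [d] as well; a monomial of degree above [d] in
   the poset shows this. *)
- have [A' lt_A'] : exists A : {set 'I_n}, (d < #|A|)%N.
    have := degP A0 PA0; rewrite leq_eqVlt => /orP[/eqP cA|]; last by exists A0.
    by exists (m A0); rewrite card_m //; apply/levelP.
  by apply: leq_trans lt_A' _; rewrite -[n in (_ <= n)%N]card_ord max_card.
- by rewrite leq_min lt_a.
- by rewrite card_m.
- by move: XA; rewrite inE => /and3P[].
Qed.

(** * The two bounds on the depth of I / J *)

Section Depth.
Variables (K : fieldType) (n d : nat) (GI GJ : {set {set 'I_n}}).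
Hypotheses (subJI : ideal_sub K GJ GI)
  (degI : forall B, B \in GI -> (d <= #|B|)%N).

Lemma up_sub a : up GJ a -> up GI a.
Proof. by move=> /(in_mideal_prod K)/subJI/in_mideal_prod. Qed.

Lemma regular_seq_hsym : (exists A, A \in level GI GJ d) ->
  regular_seq GI GJ [seq hsym K n k | k <- iota 1 d].
Proof.
move=> [A /setIdP[]]; rewrite inE => /andP[IA nJA] /eqP cA.
have maxP f : f \in [seq hsym K n k | k <- iota 1 d] -> in_maxideal f.
  by case/mapP => -[|k]; rewrite mem_iota // => _ ->; apply: in_maxideal_hsym.
split=> //.
  have reg : wreg (@sqfree K n (up GI)) (@sqfree K n (up GJ))
      [seq hsym K n k | k <- iota 1 d].
    apply: wreg_hsym => [||a|a Ia _]; try exact: monotone_up; first exact: up_sub.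
    exact: up_leq Ia.
  apply: (wregP (@in_mideal K n GI) (@in_mideal K n GJ) _).1.
  by apply: eq_wreg reg => f; apply: iff_sym; apply: in_midealP.
(* A monomial of degree [d] in I \ J survives the quotient: the terms from the sequence contribute
   nothing to its coefficient. *)
exists (sqmon K A); split; first exact/in_mideal_sqmon.
move=> [j [/in_midealP Jj [a [Ia Da]]]].
have := mcoef_sqmon K A; rewrite Da mcoefD mcoef_sum big1 ?addr0 => [nz|i _].
  case/negP: nJA; apply: (monotone_up _ (Jj (fun i => ind A i : nat) _)) => [i|].
    by rewrite /supp lt0b.
  by rewrite nz oner_neq0.
have [c ->] := maxP _ (mem_nth 0 (ltn_ord i)).
rewrite mulr_suml mcoef_sum big1 // => l _; rewrite mulrAC mulrC.
by apply: (@mcoef_mvarM_mideal _ _ GI); rewrite ?cA //;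
  apply: (idealM (ideal_in_mideal _ _)); apply: Ia.
Qed.

(* A nonzero element z of the kernel of K^(P_d) -> K^(P_(d+1)), where P_k is
   [level GI GJ k], is a Koszul cocycle of I / J of multidegree (1, ..., 1). *)
Lemma regular_seq_size (z : {set 'I_n} -> K) (fs : seq (mp K n)) :
  (exists2 A, A \in level GI GJ d & z A != 0) ->
  (forall A, A \notin level GI GJ d -> z A = 0) ->
  (forall B, B \in level GI GJ d.+1 -> \sum_(j in B) ksign K j B * z (B :\ j) = 0) ->
  regular_seq GI GJ fs -> (size fs <= d)%N.
Proof.
move=> [A XA zA] zX zker [maxfs nzd _]; rewrite leqNgt; apply/negP => lt_d.
have reg := (wregP (@in_mideal K n GI) (@in_mideal K n GJ) fs).2 nzd.
have idI := ideal_in_mideal K GI; have idJ := ideal_in_mideal K GJ.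
pose x (j : 'I_n) := mvar K n j; pose c A := mconst n (z A) * sqmon K A.
have Ic B : in_mideal GI (c B).
  have [/setIdP[]|nXB] := boolP (B \in level GI GJ d); last first.
    by rewrite /c zX // rmorph0 mul0r; apply: ideal0.
  by rewrite inE => /andP[IB _] _; apply: (idealM idI); apply/in_mideal_sqmon.
have Jc (B : {set 'I_n}) : #|B| = d.+1 -> in_mideal GJ (koszul x c B).
  move=> cB.
  have -> : koszul x c B =
      mconst n (\sum_(j in B) ksign K j B * z (B :\ j)) * sqmon K B.
    rewrite rmorph_sum mulr_suml; apply: eq_bigr => j Bj.
    rewrite (sqmonD1 K Bj) rmorphM rmorph_sign /c /x -/(ksign _ j B); ring.
  (* If [B] lies in J the value does too; if [B] lies in I \ J the kernel condition applies; if [B]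
     is outside I, so are its divisors, where [z] vanishes. *)
  have [/in_mideal_sqmon JB|nJB] := boolP (up GJ (ind B)); first exact: (idealM idJ).
  have [IB|nIB] := boolP (up GI (ind B)).
    rewrite zker; first by rewrite rmorph0 mul0r; apply: ideal0.
    by rewrite !inE IB nJB cB /=.
  rewrite big1 ?rmorph0 ?mul0r; first exact: ideal0.
  move=> j _; rewrite zX ?mulr0 //; apply: contra nIB => /setIdP[].
  by rewrite inE => /andP[IBj _] _; apply: up_indS IBj; apply: subD1set.
(* A longer regular sequence would make [c] a coboundary modulo J. Coboundaries have no term in the
   monomial of [A], so the nonzero [z A] would put this monomial in J. *)
have [w Iw Jw] := koszul_exact idI idJ maxfs reg lt_d Ic Jc.
move: XA => /setIdP[]; rewrite inE => /andP[_ nJA] /eqP cA.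
have /in_midealP Jcw := Jw A cA; case/negP: nJA.
apply: (monotone_up _ (Jcw (fun i => ind A i : nat) _)) => [i|].
  by rewrite /supp lt0b.
suff -> : mcoef (c A - koszul x w A) (fun i => ind A i) = z A by [].
have -> : - koszul x w A = \sum_(j in A) mconst n (- ksign K j A) * (x j * w (A :\ j)).
  rewrite /koszul -sumrN; apply: eq_bigr => j _.
  by rewrite rmorphN rmorph_sign mulNr mulrA.
rewrite mcoefD mcoef_mconstM mcoef_sqmon mulr1 mcoef_sum big1 ?addr0 // => j _.
by rewrite mcoef_mconstM (@mcoef_mvarM_mideal _ _ GI) ?mulr0 // cA.
Qed.

End Depth.

Theorem theorem4p3 (K : fieldType) (n d : nat) (GI GJ : {set {set 'I_n}}) :
  (0 < d)%N ->
  ideal_sub K GJ GI ->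
  (exists f : mp K n, in_mideal GI f /\ ~ in_mideal GJ f) ->
  (forall B, B \in GI -> (d <= #|B|)%N) ->
  rho_pos K GI d ->
  sdepth_eq K GI GJ d ->
  depth_eq K GI GJ d.
Proof.
move=> _ subJI [f [If nJf]] degI _ [_ sdepth_le].
have degP A : A \in poset GI GJ -> (d <= #|A|)%N.
  by rewrite inE => /andP[IA _]; apply: up_leq_card IA.
have P_neq0 : exists A, A \in poset GI GJ.
  (* If the poset were empty, the support of each monomial of [f] would lie in J, and so would
     [f]. *)
  have [P0|[A PA]] := set_0Vmem (poset GI GJ); last by exists A.
  case: nJf; apply/in_midealP; move/in_midealP: If; apply: sqfree_sub => a Ia.
  apply: contraT => nJa; have := in_set0 [set i : 'I_n | a i].
  by rewrite -P0 inE !up_ind Ia nJa.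
(* The signed incidence matrix of the first Koszul map: a nonzero entry forces [A] to be [B] with
   one element removed. *)
pose e (A B : {set 'I_n}) : K := \sum_(j in B | B :\ j == A) ksign K j B.
have [[m [inj_m mP]]|[z [z_neq0 zX zker]]] :=
    matching_or_kernel (level GI GJ d) (level GI GJ d.+1) e.
  have mP' A : A \in level GI GJ d -> m A \in level GI GJ d.+1 /\ A \subset m A.
    move=> XA; have [Ym nz] := mP A XA; split=> //; apply: contraNT nz => nsub.
    rewrite /e big_pred0 // => j; apply: contraNF nsub => /andP[_ /eqP eA].
    by rewrite -{1}eA subD1set.
  have [Pt stPt] := matching_partition K degP P_neq0 inj_m mP'.
  by rewrite ltnNge sdepth_le.
split.
  exists [seq hsym K n k | k <- iota 1 d]; split; last by rewrite size_map size_iota.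
  (* The nonzero kernel vector also provides a monomial of degree [d] in I \ J. *)
  by apply: regular_seq_hsym => //; case: z_neq0 => A XA _; exists A.
move=> fs; apply: (regular_seq_size degI z_neq0 zX) => B YB.
(* After exchanging the sums, each [j] in [B] selects the single set [B :\ j], and [z] vanishes when
   that set is not in the level. *)
rewrite -[RHS](zker B YB) /e.
under [RHS]eq_bigr do rewrite mulr_sumr.
rewrite (exchange_big_dep (mem B)) /=; last by move=> A j _ /andP[].
apply: eq_bigr => j Bj; rewrite (big_mkcond (fun A => _ && _)) (bigD1 (B :\ j)) //=.
rewrite Bj eqxx !andbT big1 ?addr0; last first.
  by move=> A /negPf ne_A; rewrite [_ == A]eq_sym ne_A !andbF.
by case: ifP => [_|/negbT nX]; [apply: mulrC | rewrite (zX _ nX) mulr0].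
Qed.
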